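(* Let $n\ge1,m,k,l$ be non-negative integers with $m,k\le n$ and $m+k-n\le l\le\min(m,k)$, and let $X$ be a random variable with $\Pr[X=x]=p(x\mid n,m,k,l)$ for $x=0,1,\dots,\lfloor n/2\rfloor$. Then \[ \frac{\mathbb V[X]}{n^2}=\frac{\mathbb E[X]}{n}\Bigl(1-\frac{\mathbb E[X]}{n}\Bigr)+\frac{\mathbb E[X]}{n^2}-\eta,\qquad \eta:=\frac{m(n-m)-(m-l)(n-m-k+l)}{n^2}. \]
   Context: Let $M:=m-l$, $N:=n-m-k+l$. Let $\mathbb{C}^2$ have orthonormal basis $|0\rangle,|1\rangle$ and give $(\mathbb{C}^2)^{\otimes n}$ the induced Hermitian inner product. Define $|\Xi_{n,m|k,l}\rangle:=|1\rangle^{\otimes l}\otimes|0\rangle^{\otimes(k-l)}\otimes\binom{M+N}{M}^{-1/2}\sum_{I}|I\rangle$, the sum over all $I\in\{0,1\}^{n-k}$ with exactly $M$ ones (where $|i_1\cdots i_r\rangle=|i_1\rangle\otimes\cdots\otimes|i_r\rangle$). $\mathfrak S_n$ acts on $(\mathbb{C}^2)^{\otimes n}$ by permuting tensor factors. For $0\le x\le\lfloor n/2\rfloor$, $\mathsf P_{(n-x,x)}$ is the orthogonal projection onto the isotypic component of the irreducible $\mathfrak S_n$-representation labelled by the partition $(n-x,x)$, and $p(x\mid n,m,k,l):=\langle\Xi_{n,m|k,l}|\mathsf P_{(n-x,x)}|\Xi_{n,m|k,l}\rangle$; these values form a probability distribution on $\{0,\dots,\lfloor n/2\rfloor\}$.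 *)

(* Defs.v *)
From HB Require Import structures.
From mathcomp Require Import all_boot all_order fingroup perm all_algebra algC.
Import Order.TTheory GRing.Theory Num.Theory.
Local Open Scope ring_scope.

(* Computational basis: |b> for b : 'I_n -> bool  (true = |1>, false = |0>);
   a vector is its coordinate function. *)
Definition basis_idx (n : nat) := {ffun 'I_n -> bool}.
Definition tvec (n : nat) := basis_idx n -> algC.

Definition inner n (u v : tvec n) : algC := \sum_(b : basis_idx n) (u b)^* * v b.

Definition perm_act n (s : 'S_n) (v : tvec n) : tvec n :=
  fun b => v [ffun i => b (s i)].

Definition Mpar (m l : nat) : nat := (m - l)%N.
Definition Npar (n m k l : nat) : nat := (n + l - (m + k))%N.

Definition Xi (n m k l : nat) : tvec n := fun b =>
  if [&& [forall i : 'I_n, (i < l)%N ==> b i],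
         [forall i : 'I_n, (l <= i < k)%N ==> ~~ b i] &
         #|[set i : 'I_n | (k <= i)%N && b i]| == Mpar m l]
  then (sqrtC ('C(Mpar m l + Npar n m k l, Mpar m l))%:R)^-1
  else 0.

(* Tabloids of shape (n-x,x) are identified with their second row, an
   x-subset of 'I_n.  The tableau t_tau (tau : 'S_n) has entry tau(c) in cell
   c of the canonical numbering: row 1 holds positions 0..n-x-1, row 2 holds
   positions n-x..n-1, and column j (j < x) is {j, n-x+j}.  The polytabloid
   e_tau = sum_{S subset of columns} (-1)^|S| {t_tau with columns in S swapped};
   below R tau S is the second row of that swapped tabloid. *)
Definition swapped_row2 n x (tau : 'S_n) (S : {set 'I_x}) : {set 'I_n} :=
  [set i : 'I_n | let c := val ((tau^-1)%g i) in
     if (c < x)%N then [exists j : 'I_x, (val j == c) && (j \in S)]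
     else (n - x <= c)%N && [exists j : 'I_x, (val j == c - (n - x))%N && (j \notin S)]].

Definition polytabloid n x (tau : 'S_n) (T : {set 'I_n}) : algC :=
  \sum_(S : {set 'I_x}) (-1) ^+ #|S| * (T == swapped_row2 n x tau S)%:R.

Definition specht_mx n x : 'M[algC]_(#|{perm 'I_n}|, #|{set 'I_n}|) :=
  \matrix_(i, j) polytabloid n x (enum_val i) (enum_val j).

(* Permutation action of sigma on tabloid space (row-vector convention):
   the tabloid with second row T is sent to the one with second row sigma(T). *)
Definition tabloid_perm_mx n (s : 'S_n) : 'M[algC]_(#|{set 'I_n}|) :=
  \matrix_(i, j) ((enum_val j : {set 'I_n}) == (s @: (enum_val i : {set 'I_n})))%:R.

(* Character of the Specht module: trace of sigma restricted to the row space
   of specht_mx (an S_n-invariant subspace), computed in the basis row_base. *)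
Definition specht_char n x (s : 'S_n) : algC :=
  let B := row_base (specht_mx n x) in
  \tr (B *m tabloid_perm_mx n s *m pinvmx B).

Definition specht_dim n x : nat := \rank (specht_mx n x).

Definition isotypic_proj n x (v : tvec n) : tvec n := fun b =>
  (specht_dim n x)%:R / (n`!)%:R *
  \sum_(s : 'S_n) (specht_char n x s)^* * perm_act n s v b.

Definition pdist (n m k l x : nat) : algC :=
  inner n (Xi n m k l) (isotypic_proj n x (Xi n m k l)).

Definition EX (n m k l : nat) : algC :=
  \sum_(0 <= x < (n./2).+1) x%:R * pdist n m k l x.

Definition VX (n m k l : nat) : algC :=
  \sum_(0 <= x < (n./2).+1) (x%:R - EX n m k l) ^+ 2 * pdist n m k l x.

Definition eta_param (n m k l : nat) : algC :=
  ((m * (n - m))%:R - ((m - l) * (n + l - (m + k)))%:R) / (n ^ 2)%:R.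

(* Main.v *)
(* Identify the n-qubit basis with subsets of 'I_n, so that tensor space is the
   sum of all the tabloid modules, and let C be the sum of 1 - (a b) over all
   ordered pairs (a, b).  On the Specht module S^x, the central element C acts by
   the scalar 2 x (n + 1 - x), so that the expectation of 2 X (n + 1 - X) is
   <Xi| C |Xi>, a count of the transpositions that move the support of Xi out of
   itself.  Together with the fact that the probabilities sum to 1, this gives
   the variance.

   The projections sum to 1 for the following reasons.  The column antisymmetrizer
   of a polytabloid e maps the whole weight space of e to multiples of e (James),
   so every endomorphism of S^x is a scalar and the x-th projection is the
   identity on S^x.  It vanishes on the other S^y because C separates them, and it
   commutes with raising operators.  Tensor space is generated from the Specht
   modules by raising operators: modulo the generated subspace, the antisymmetrizer
   of a set of disjoint pairs takes the same value on all the subsets that agree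
   on the pairs and have the same size, by induction on the number of remaining
   positions, and the sum of these values lies in the subspace. *)

Require Import Defs.
From HB Require Import structures.
From mathcomp Require Import all_boot all_order fingroup perm all_algebra algC.
From mathcomp Require Import mxrepresentation classfun character.
From mathcomp Require Import zify ring.
Set Implicit Arguments. Unset Strict Implicit. Unset Printing Implicit Defensive.
Import Order.TTheory GRing.Theory Num.Theory.
Local Open Scope ring_scope.

(** * Antisymmetrizers of disjoint pairs *)

Section Antisymmetrizers.
Variable n : nat.
Local Notation N := #|{set 'I_n}|.
Implicit Types (A B T : {set 'I_n}) (s : 'S_n) (p : seq ('I_n * 'I_n)).
Local Notation Tm := (@tabloid_perm_mx n).

Definition delta A : 'rV[algC]_N := delta_mx 0 (enum_rank A).

Lemma delta_mul A q (M : 'M[algC]_(N, q)) : delta A *m M = row (enum_rank A) M.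
Proof. by rewrite rowE. Qed.

Lemma row_delta q (M : 'M[algC]_(N, q)) i : row i M = delta (enum_val i) *m M.
Proof. by rewrite delta_mul enum_valK. Qed.

Lemma mem_perm_imset s A i : (i \in s @: A) = ((s^-1)%g i \in A).
Proof. by rewrite -{1}(permKV s i) mem_imset //; apply: perm_inj. Qed.

Lemma delta_perm A s : delta A *m Tm s = delta (s @: A).
Proof.
rewrite delta_mul; apply/rowP => j; rewrite !mxE eqxx enum_rankK /=.
by rewrite -(inj_eq enum_rank_inj) enum_valK.
Qed.

Lemma perm_mulmxE s q (M : 'M[algC]_(N, q)) i j :
  (Tm s *m M) i j = M (enum_rank (s @: enum_val i)) j.
Proof.
have := congr1 (fun v : 'rV_N => (v *m M) 0 j) (delta_perm (enum_val i) s).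
by rewrite -mulmxA !delta_mul !mxE enum_valK => ->.
Qed.

Lemma tabloid_perm1 : Tm 1%g = 1%:M.
Proof.
apply/row_matrixP => i; rewrite !row_delta delta_perm mulmx1.
by congr delta; apply/setP => j; rewrite mem_perm_imset invg1 perm1.
Qed.

Lemma tabloid_permM s t : Tm (s * t)%g = Tm s *m Tm t.
Proof.
apply/row_matrixP => i; rewrite !row_delta mulmxA !delta_perm.
by congr delta; apply/setP => j; rewrite !mem_perm_imset invMg permM.
Qed.

Definition supp p := unzip1 p ++ unzip2 p.

(** The sign of [A] in the antisymmetrization over the pairs of distinct points in [p]: 0 unless [A]
    meets each pair in exactly one point, otherwise -1 to the number of second entries in [A]. *)
Definition weight p A : algC :=
  \prod_(ab <- p) ((ab.1 \in A)%:R - (ab.2 \in A)%:R).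

Definition agree p A T := [forall i, (i \notin supp p) ==> ((i \in A) == (i \in T))].

Lemma agreeP p A T :
  reflect (forall i, i \notin supp p -> (i \in A) = (i \in T)) (agree p A T).
Proof.
apply: (iffP forallP) => [h i hi|h i].
  by have := h i; rewrite hi => /eqP.
by apply/implyP => /h ->.
Qed.

(** The column antisymmetrizer of a tableau whose columns of height two are the pairs in [p]. It
    acts on subsets of every size at once. *)
Definition colmx p : 'M[algC]_N :=
  foldr (fun ab M => (1%:M - Tm (tperm ab.1 ab.2)) *m M) 1%:M p.

(* The polytabloid whose columns are the pairs in p. *)
Definition evec p : 'rV[algC]_N :=
  \row_j ((agree p (enum_val j) set0)%:R * weight p (enum_val j)).

Lemma supp_cons a b p : perm_eq (supp ((a, b) :: p)) [:: a, b & supp p].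
Proof. by rewrite /supp /= perm_cons perm_catC /= perm_cons perm_catC. Qed.

Lemma mem_supp p a b : (a, b) \in p -> (a \in supp p) /\ (b \in supp p).
Proof.
by move=> h; split; rewrite mem_cat; apply/orP; [left|right]; apply/mapP; exists (a, b).
Qed.

Lemma weight_imset p A s : (forall i, i \in supp p -> s i = i) ->
  weight p (s @: A) = weight p A.
Proof.
move=> h; apply: eq_big_seq => -[a b] /mem_supp [/h ha /h hb] /=.
have E i : s i = i -> (i \in s @: A) = (i \in A).
  by move=> hi; rewrite -{1}hi mem_imset //; apply: perm_inj.
by rewrite !E.
Qed.

(* On a pair (a, b), the operator 1 - (a b) is the rank-one matrix f f^T with
   f A = [a in A] - [b in A]. *)
Lemma colmxE p : uniq (supp p) -> forall i j, colmx p i j =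
  (agree p (enum_val i) (enum_val j))%:R *
  (weight p (enum_val i) * weight p (enum_val j)).
Proof.
elim: p => [|[a b] p IH] u i j.
  rewrite /= mxE /weight !big_nil !mulr1; congr (_%:R); congr nat_of_bool.
  apply/eqP/agreeP => [-> //|h]; apply: enum_val_inj.
  by apply/setP => k; apply: h.
have := u; rewrite (perm_uniq (supp_cons a b p)) /= inE negb_or.
case/and3P=> /andP [nab ha] hb up; have {}IH := IH up.
rewrite [colmx _]/= mulmxBl mul1mx [LHS]mxE [X in _ + X]mxE perm_mulmxE !IH enum_rankK.
set A := enum_val i; set T := enum_val j.
have hw : weight p (tperm a b @: A) = weight p A.
  apply: weight_imset => k hk; rewrite tpermD //.
    by apply: contraNneq ha => ->.
  by apply: contraNneq hb => ->.
rewrite hw /weight !big_cons -!/(weight _ _) /=.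
have hs k : (k \in supp ((a, b) :: p)) = [|| k == a, k == b | k \in supp p].
  by rewrite (perm_mem (supp_cons a b p)) !inE.
have agA (A' : {set 'I_n}) : agree p A' T =
   [&& agree ((a, b) :: p) A' T, (a \in A') == (a \in T) & (b \in A') == (b \in T)].
  apply/agreeP/and3P => [h|[/agreeP h /eqP h1 /eqP h2] k hk].
    split; [|by rewrite h|by rewrite h].
    by apply/agreeP => k; rewrite hs !negb_or => /and3P [_ _ /h].
  case: (eqVneq k a) => [-> //|ka]; case: (eqVneq k b) => [-> //|kb].
  by apply: h; rewrite hs !negb_or ka kb.
have sw : agree ((a, b) :: p) (tperm a b @: A) T = agree ((a, b) :: p) A T.
  apply/agreeP/agreeP => h k hk; rewrite -h //; move: hk;
    rewrite hs !negb_or => /and3P [ka kb _];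
    by rewrite mem_perm_imset tpermV tpermD // eq_sym.
(* Only the traces of [A] and [T] on {a, b} still matter; on these four subsets, the identity minus
   the swap is the rank-one matrix f f^T. *)
rewrite !agA sw !mem_perm_imset tpermV tpermL tpermR.
by case: (agree _ A T); case: (a \in A); case: (b \in A); case: (a \in T);
  case: (b \in T) => /=; ring.
Qed.

Lemma weight_neq0 p A : weight p A != 0 ->
  forall ab, ab \in p -> (ab.1 \in A) = (ab.2 \notin A).
Proof.
rewrite prodf_seq_neq0 => /allP h ab /h /=.
by case: (ab.1 \in A); case: (ab.2 \in A); rewrite //= subrr eqxx.
Qed.

Lemma count_supp p A : weight p A != 0 -> count (mem A) (supp p) = size p.
Proof.
move=> /weight_neq0; rewrite count_cat !count_map.
elim: p => //= -[a b] p IH h.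
have := h _ (mem_head _ _); rewrite /= => ->.
rewrite addnACA IH; last by move=> ab hab; apply: h; rewrite inE hab orbT.
by case: (b \in A).
Qed.

Lemma card_supp p A : uniq (supp p) -> weight p A != 0 ->
  #|[set i in A | i \in supp p]| = size p.
Proof.
move=> u /count_supp <-; rewrite -size_filter cardE; apply: perm_size.
apply: uniq_perm; rewrite ?enum_uniq ?filter_uniq // => i.
by rewrite mem_enum inE mem_filter.
Qed.

Lemma agree0P p A : reflect {subset A <= supp p} (agree p A set0).
Proof.
apply: (iffP (agreeP _ _ _)) => [h i hi|h i]; last first.
  by rewrite inE; apply: contraNF; apply: h.
by apply: contraLR hi => /h; rewrite inE => ->.
Qed.

(** A set of nonzero weight already has [size p] points in the support, so having no others is a
    matter of cardinality. *)
Lemma agree0_card p A : uniq (supp p) -> weight p A != 0 ->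
  agree p A set0 = (#|A| == size p).
Proof.
move=> u w; have h := card_supp u w.
have sAA : [set i in A | i \in supp p] \subset A.
  by apply/subsetP => i; rewrite inE => /andP [].
rewrite -h; apply/agree0P/idP => [hs|/eqP hc].
  rewrite eqn_leq [X in _ && X]subset_leq_card // andbT subset_leq_card //.
  by apply/subsetP => i hi; rewrite inE hi hs.
have /eqP E : [set i in A | i \in supp p] == A by rewrite eqEcard sAA hc /=.
by move=> i; rewrite -{1}E inE => /andP [].
Qed.

Lemma evec_weight p (i : 'I_N) : uniq (supp p) ->
  #|enum_val i| != size p -> evec p 0 i = 0.
Proof.
move=> u h; rewrite mxE; case: (eqVneq (weight p (enum_val i)) 0) => [->|w].
  by rewrite mulr0.
by rewrite agree0_card // (negbTE h) mul0r.
Qed.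

(** A set of size [size p] and nonzero weight lies inside the support. Agreeing with it off the
    support then means lying inside the support too, and the matrix of [colmxE] becomes the rank-one
    matrix of [evec p]. *)
Lemma mul_colmx p (v : 'rV[algC]_N) : uniq (supp p) ->
  (forall i : 'I_N, #|enum_val i| != size p -> v 0 i = 0) ->
  v *m colmx p = (v *m (evec p)^T) 0 0 *: evec p.
Proof.
move=> u hv; apply/rowP => j; rewrite !mxE mulr_suml; apply: eq_bigr => i _.
rewrite colmxE // !mxE.
case: (eqVneq #|enum_val i| (size p)) => [hi|/hv ->]; last first.
  by rewrite !mul0r.
case: (eqVneq (weight p (enum_val i)) 0) => [->|w]; first by rewrite !(mul0r, mulr0).
have ag : agree p (enum_val i) set0 by rewrite agree0_card // hi.
rewrite ag mul1r.
have -> : agree p (enum_val i) (enum_val j) = agree p (enum_val j) set0.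
  have /agreeP hi0 := ag.
  by apply/agreeP/agreeP => h k hk; have := h k hk; rewrite hi0 // => <-.
ring.
Qed.

Definition tops p : {set 'I_n} := [set i in unzip1 p].

Lemma supp_disj p a b : uniq (supp p) -> a \in unzip1 p -> b \in unzip2 p -> a != b.
Proof.
rewrite cat_uniq => /and3P [_ /hasPn h _] ha /h /= hb.
by apply: contraNneq hb => <-.
Qed.

Lemma weight_tops p : uniq (supp p) -> weight p (tops p) = 1.
Proof.
move=> u; rewrite /weight big_seq big1 // => -[a b] hab /=.
have ha : a \in unzip1 p by apply/mapP; exists (a, b).
have hb : b \in unzip2 p by apply/mapP; exists (a, b).
have hbn : b \in unzip1 p = false.
  by apply/negP => hb1; have := supp_disj u hb1 hb; rewrite eqxx.
by rewrite !inE ha hbn subr0.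
Qed.

Lemma agree_tops p : agree p (tops p) set0.
Proof. by apply/agree0P => i; rewrite inE mem_cat => ->. Qed.

Lemma card_tops p : uniq (supp p) -> #|tops p| = size p.
Proof.
move=> u; apply/eqP; rewrite -agree0_card ?agree_tops // weight_tops //.
exact: oner_neq0.
Qed.

Lemma delta_colmx p A : uniq (supp p) -> #|A| = size p ->
  delta A *m colmx p = weight p A *: evec p.
Proof.
move=> u hA; rewrite mul_colmx //; last first.
  move=> i hi; rewrite mxE eqxx /=; case: eqP => // E; move: hi.
  by rewrite E enum_rankK hA eqxx.
rewrite delta_mul !mxE enum_rankK; congr (_ *: _).
case: (eqVneq (weight p A) 0) => [->|w]; first by rewrite mulr0.
by rewrite agree0_card // hA eqxx mul1r.
Qed.

(** The factor is the squared norm of [evec p], whose entries are real; it is positive because the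
    entry at [tops p] is 1. *)
Lemma evec_colmx p : uniq (supp p) ->
  exists2 c, c != 0 & evec p *m colmx p = c *: evec p.
Proof.
move=> u; exists ((evec p *m (evec p)^T) 0 0); last first.
  by apply: mul_colmx => // i; apply: evec_weight.
have re i : 0 <= evec p 0 i * evec p 0 i.
  rewrite -expr2 real_exprn_even_ge0 // mxE rpredM ?realn //.
  by apply: rpred_prod => ab _; rewrite rpredB ?realn.
rewrite mxE (bigD1 (enum_rank (tops p))) //= !mxE.
rewrite enum_rankK agree_tops weight_tops // !mulr1 gt_eqF // ltr_wpDr ?ltr01 //.
by apply: sumr_ge0 => i _; rewrite [(evec p)^T _ _]mxE.
Qed.

End Antisymmetrizers.

(** * Polytabloids and the class sum of transpositions *)

Section Polytabloids.
Variable n : nat.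
Local Notation N := #|{set 'I_n}|.
Implicit Types (A B T : {set 'I_n}) (s : 'S_n) (p : seq ('I_n * 'I_n)).
Local Notation Tm := (@tabloid_perm_mx n).

Lemma bot_subproof x (hx : (x.*2 <= n)%N) (j : 'I_x) : (n - x + j < n)%N.
Proof. by have := ltn_ord j; lia. Qed.

Lemma top_subproof x (hx : (x.*2 <= n)%N) : (x <= n)%N.
Proof. by lia. Qed.

Definition botc x hx j : 'I_n := Ordinal (@bot_subproof x hx j).
Definition topc x hx j : 'I_n := widen_ord (@top_subproof x hx) j.

(** The bottom entry comes first because the unswapped tabloid, whose second row consists of the
    bottom entries, has sign +1. *)
Definition columns x hx s := [seq (s (@botc x hx j), s (topc hx j)) | j <- enum 'I_x].

Lemma columns_supp x hx s : supp (@columns x hx s) =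
  [seq s (botc hx j) | j <- enum 'I_x] ++ [seq s (topc hx j) | j <- enum 'I_x].
Proof. by rewrite /supp /columns /unzip1 /unzip2 -!map_comp. Qed.

Lemma columns_uniq x hx s : uniq (supp (@columns x hx s)).
Proof.
have ib : injective (fun j => s (botc hx j)).
  by move=> i j /perm_inj /(congr1 val) /= ?; apply: val_inj => /=; lia.
have it : injective (fun j => s (topc hx j)).
  by move=> i j /perm_inj /(congr1 val) /= ?; apply: val_inj => /=.
rewrite columns_supp cat_uniq (map_inj_uniq ib) (map_inj_uniq it) !enum_uniq andbT.
apply/hasPn => _ /mapP [j _ ->]; apply/negP => /mapP [i _].
by move=> /perm_inj /(congr1 val) /=; have := ltn_ord i; have := ltn_ord j; lia.
Qed.

Lemma size_columns x hx s : size (@columns x hx s) = x.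
Proof. by rewrite size_map size_enum_ord. Qed.

Lemma swapped_bot x hx s (S : {set 'I_x}) j :
  (s (@botc x hx j) \in swapped_row2 n x s S) = (j \notin S).
Proof.
rewrite inE permK /=; have hj := ltn_ord j.
have -> : (n - x + j < x)%N = false by lia.
have -> : (n - x <= n - x + j)%N by lia.
apply/existsP/idP => [[i /andP [/eqP hi]]|hS]; last first.
  by exists j; rewrite hS andbT; apply/eqP; lia.
by suff -> : i = j by []; apply: val_inj => /=; lia.
Qed.

Lemma swapped_top x hx s (S : {set 'I_x}) j :
  (s (@topc x hx j) \in swapped_row2 n x s S) = (j \in S).
Proof.
rewrite inE permK /= ltn_ord.
apply/existsP/idP => [[i /andP [/eqP hi]]|hS]; last by exists j; rewrite eqxx.
by suff -> : i = j by []; apply: val_inj => /=; lia.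
Qed.

Lemma swapped_supp x hx s (S : {set 'I_x}) :
  {subset swapped_row2 n x s S <= supp (@columns x hx s)}.
Proof.
move=> i; rewrite inE /= columns_supp mem_cat.
have ei := permKV s i; set c := (s^-1)%g i in ei *; case: ifP => [h|_].
  case/existsP => j /andP [/eqP hj _]; apply/orP; right; apply/mapP.
  by exists j; rewrite ?mem_enum // -[LHS]ei; congr (s _); apply: val_inj.
case/andP => h /existsP [j /andP [/eqP hj _]].
apply/orP; left; apply/mapP; exists j; rewrite ?mem_enum // -[LHS]ei.
by congr (s _); apply: val_inj => /=; rewrite hj; lia.
Qed.

Lemma swapped_eq x hx s (S : {set 'I_x}) T :
  (T == swapped_row2 n x s S) = agree (@columns x hx s) T set0 &&
  [forall j, ((s (topc hx j) \in T) == (j \in S)) &&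
             ((s (botc hx j) \in T) == (j \notin S))].
Proof.
apply/eqP/andP => [->|[/agree0P hT /forallP h]].
  split; first by apply/agree0P; apply: swapped_supp.
  by apply/forallP => j; rewrite swapped_top swapped_bot !eqxx.
apply/setP => i.
case: (boolP (i \in supp (columns hx s))); last first.
  by move=> hi; rewrite (contraNF (@hT i) hi) (contraNF (@swapped_supp _ hx s S i) hi).
rewrite columns_supp mem_cat => /orP [] /mapP [j _ ->];
  have /andP [/eqP h1 /eqP h2] := h j.
  by rewrite swapped_bot.
by rewrite swapped_top.
Qed.

(** Expanding the product [weight] over the columns yields the signed sum over the sets of swapped
    columns. *)
Lemma polytabloidE x hx s T : polytabloid n x s T =
  (agree (@columns x hx s) T set0)%:R * weight (columns hx s) T.
Proof.
rewrite /polytabloid.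
under eq_bigr => S _ do rewrite (swapped_eq hx) -mulnb natrM mulrCA.
rewrite -big_distrr /=; congr (_ * _).
rewrite /weight big_map big_enum /=.
(* [F] is the factor of a swapped column, [G] that of an unswapped one. *)
pose F j : algC := - ((s (topc hx j) \in T) && (s (botc hx j) \notin T))%:R.
pose G j : algC := ((s (topc hx j) \notin T) && (s (botc hx j) \in T))%:R.
transitivity (\prod_j (F j + G j)); last first.
  apply: eq_bigr => j _; rewrite /F /G.
  by case: (_ \in T); case: (_ \in T) => /=; ring.
rewrite bigA_distr; apply: eq_big => [S|S _]; first by rewrite inE.
transitivity (\prod_j ((-1) ^+ (j \in S) * (((s (topc hx j) \in T) == (j \in S)) &&
             ((s (botc hx j) \in T) == (j \notin S)))%:R) : algC).
  rewrite big_split /=.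
  congr (_ * _).
    rewrite -sum1_card big_mkcond /= (big_morph _ (exprD _) (expr0 _)).
    by apply: eq_bigr => j _; case: (j \in S).
  case: forallP => [h|h]; first by rewrite big1 // => j _; rewrite h.
  have [j hj] : exists j, ~~ (((s (topc hx j) \in T) == (j \in S)) &&
             ((s (botc hx j) \in T) == (j \notin S))).
    by apply/existsP; rewrite -negb_forall; apply/forallP.
  by rewrite (bigD1 j) //= (negbTE hj) mul0r.
apply: eq_bigr => j _; rewrite /F /G.
by case: (j \in S); case: (_ \in T); case: (_ \in T) => /=; ring.
Qed.

Lemma row_specht x hx s :
  row (enum_rank s) (specht_mx n x) = evec (@columns x hx s).
Proof. by apply/rowP => j; rewrite !mxE enum_rankK (polytabloidE hx). Qed.

(** Each list is completed by its missing points to an enumeration of ['I_n], and the permutation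
    matches the two enumerations position by position. *)
Lemma perm_map_uniq (s1 s2 : seq 'I_n) : uniq s1 -> uniq s2 -> size s1 = size s2 ->
  exists s : 'S_n, map s s1 = s2.
Proof.
move=> u1 u2 hs.
pose ext (r : seq 'I_n) := r ++ [seq i <- enum 'I_n | i \notin r].
have ext_uniq r : uniq r -> uniq (ext r).
  move=> u; rewrite cat_uniq u filter_uniq ?enum_uniq //= andbT.
  by apply/hasPn => i; rewrite mem_filter => /andP [].
have ext_mem r i : i \in ext r.
  by rewrite mem_cat mem_filter mem_enum andbT orbN.
have ext_size r : uniq r -> size (ext r) = n.
  move=> u; rewrite -[RHS]card_ord cardE; apply: perm_size.
  by apply: uniq_perm; rewrite ?ext_uniq ?enum_uniq // => i; rewrite ext_mem mem_enum.
pose f i := nth i (ext s2) (index i (ext s1)).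
have fi i : (index i (ext s1) < size (ext s2))%N.
  by rewrite ext_size // -[X in (_ < X)%N](ext_size s1) // index_mem.
have f_inj : injective f.
  move=> i j; rewrite /f (set_nth_default j i) //.
  move=> /eqP; rewrite nth_uniq ?ext_uniq // => /eqP h.
  by rewrite -(nth_index i (ext_mem s1 i)) h (nth_index i (ext_mem s1 j)).
exists (perm f_inj).
case: (posnP (size s1)) => [/size0nil e1|].
  by move: hs; rewrite e1 /= => /esym/size0nil ->.
case: s1 @f fi f_inj u1 hs => // i0 s1 f fi f_inj u1 hs _.
apply: (@eq_from_nth _ i0) => [|i]; rewrite size_map // => hi.
rewrite (nth_map i0) // permE /f index_cat mem_nth // index_uniq //.
by rewrite nth_cat -hs hi; apply: set_nth_default; rewrite -hs.
Qed.

(** This places [evec p] in a Specht module for an arbitrary list of disjoint pairs. *)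
Lemma columns_surj p : uniq (supp p) ->
  exists hx s, @columns (size p) hx s = p.
Proof.
move=> u.
have hx : ((size p).*2 <= n)%N.
  have := max_card (mem (supp p)).
  by rewrite (card_uniqP u) card_ord size_cat !size_map addnn.
have sz q : size (supp q) = (size q).*2 by rewrite size_cat !size_map addnn.
have [|s hs] := perm_map_uniq (columns_uniq hx 1%g) u.
  by rewrite !sz size_columns.
exists hx, s; move: (size_enum_ord (size p)) hs; rewrite columns_supp /columns.
move: (enum _) => e he; rewrite map_cat -!map_comp /supp.
move/eqP; rewrite eqseq_cat; last by rewrite !size_map.
case/andP => /eqP h1 /eqP h2; apply: etrans (zip_unzip p); rewrite -h1 -h2 zip_map.
by apply: eq_map => j /=; rewrite !perm1.
Qed.

(* The pairs are ordered, so this is twice the sum over transpositions. *)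
Definition casimir : 'M[algC]_N := \sum_a \sum_b (1%:M - Tm (tperm a b)).

Lemma casimir_perm s : Tm s *m casimir = casimir *m Tm s.
Proof.
rewrite /casimir mulmx_sumr mulmx_suml (reindex_inj (@perm_inj _ s)).
apply: eq_bigr => a _; rewrite mulmx_sumr mulmx_suml (reindex_inj (@perm_inj _ s)).
apply: eq_bigr => b _; rewrite mulmxBl mulmxBr mul1mx mulmx1 -!tabloid_permM.
by rewrite -tpermJ conjgE mulKVg.
Qed.

Lemma comm_colmx p (M : 'M[algC]_N) : (forall s, Tm s *m M = M *m Tm s) ->
  colmx p *m M = M *m colmx p.
Proof.
move=> h; elim: p => [|ab p IH] /=; first by rewrite mul1mx mulmx1.
by rewrite -mulmxA IH !mulmxA mulmxBl mulmxBr mul1mx mulmx1 h.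
Qed.

Lemma weight_swap p A a b : uniq (supp p) -> (a, b) \in p ->
  weight p (tperm a b @: A) = - weight p A.
Proof.
elim: p => // -[c d] p IH; rewrite (perm_uniq (supp_cons c d p)) /= inE negb_or.
case/and3P => /andP [ncd hc] hd u; rewrite inE => /orP [/eqP [-> ->]|hab].
  rewrite /weight !big_cons -!/(weight _ _) /= !mem_perm_imset tpermV tpermL tpermR.
  rewrite weight_imset; first by ring.
  move=> i hi; rewrite tpermD //; first by apply: contraNneq hc => ->.
  by apply: contraNneq hd => ->.
have [ha hb] := mem_supp hab.
rewrite /weight !big_cons -!/(weight _ _) /= IH // !mem_perm_imset tpermV.
rewrite !tpermD ?mulrN //.
- by apply: contraNneq hd => <-.
- by apply: contraNneq hd => <-.
- by apply: contraNneq hc => <-.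
- by apply: contraNneq hc => <-.
Qed.

Lemma tperm_imset_id A a b : (a \in A) = (b \in A) -> tperm a b @: A = A.
Proof.
move=> h; apply/setP => i; rewrite mem_perm_imset tpermV.
by case: tpermP => // ->.
Qed.

(** A transposition moves [A] only if it exchanges a point of [A] with a point outside; each such
    pair is counted in both orders. *)
Lemma sum_tperm A (h : {set 'I_n} -> algC) :
  \sum_a \sum_b (h A - h (tperm a b @: A)) =
  (\sum_(a in A) \sum_(b in ~: A) (h A - h (tperm a b @: A))) *+ 2.
Proof.
pose f a b := h A - h (tperm a b @: A).
have f0 a b : (a \in A) = (b \in A) -> f a b = 0.
  by move=> e; rewrite /f tperm_imset_id ?subrr.
rewrite (bigID (mem A)) /= mulr2n; congr (_ + _).
  apply: eq_bigr => a ha; rewrite (bigID (mem A)) /= big1 ?add0r.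
    by apply: eq_bigl => b; rewrite inE.
  by move=> b hb; apply: f0; rewrite ha hb.
rewrite (eq_bigr (fun a => \sum_(b in A) f a b)); last first.
  move=> a ha; rewrite (bigID (mem A)) /= [X in _ + X]big1 ?addr0 //.
  by move=> b hb; apply: f0; rewrite (negbTE ha) (negbTE hb).
rewrite exchange_big; apply: eq_bigr => a ha /=.
by apply: eq_big => [b|b _]; [rewrite inE|rewrite /f tpermC].
Qed.

(** Since [casimir] commutes with the antisymmetrizer and [evec p] is the antisymmetrized
    [delta (tops p)], the scalar can be read off from the weights of the swaps of [tops p]. *)
Lemma evec_casimir p : uniq (supp p) -> evec p *m casimir =
  (size p * (n.+1 - size p)).*2%:R *: evec p.
Proof.
move=> u; have hw := weight_tops u; set A := tops p.
have {1}-> : evec p = delta A *m colmx p.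
  by rewrite delta_colmx ?card_tops // hw scale1r.
rewrite -mulmxA comm_colmx; last exact: casimir_perm.
have -> : delta A *m (casimir *m colmx p) =
    (\sum_a \sum_b (weight p A - weight p (tperm a b @: A))) *: evec p.
  rewrite mulmxA mulmx_sumr mulmx_suml scaler_suml; apply: eq_bigr => a _.
  rewrite mulmx_sumr mulmx_suml scaler_suml; apply: eq_bigr => b _.
  rewrite mulmxBr mulmx1 delta_perm mulmxBl !delta_colmx ?card_tops //.
    by rewrite scalerBl.
  by rewrite card_imset ?card_tops //; apply: perm_inj.
congr (_ *: _); rewrite sum_tperm -mul2n natrM mulr_natl; congr (_ *+ 2).
(* For a fixed [a], exchanging it with its partner contributes 1 - (-1) = 2. Each of the other n - x
   - 1 exchanges, where x is [size p], empties the pair of [a] and contributes 1. *)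
rewrite (eq_bigr (fun=> (n.+1 - size p)%:R)); last first.
  move=> a; rewrite inE => /mapP [[a' b] hab /= e]; move: hab; rewrite -{a'}e => hab.
  have ha : a \in A by rewrite inE; apply/mapP; exists (a, b).
  have hb : b \notin A.
    have := weight_neq0 (p := p) (A := A); rewrite hw oner_neq0 => /(_ isT _ hab) /=.
    by rewrite ha => <-.
  have hpn : (size p <= n)%N.
    by rewrite -(card_tops u) -[X in (_ <= X)%N]card_ord max_card.
  rewrite sumrB sumr_const cardsCs setCK card_ord card_tops // hw.
  rewrite (bigD1 b) /=; last by rewrite inE.
  rewrite weight_swap // hw big1 ?addr0 ?opprK.
    by rewrite subSn // -natr1.
  move=> c; rewrite inE => /andP [hc ncb].
  apply/eqP; apply: contraT => /weight_neq0 /(_ _ hab) /=.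
  rewrite !mem_perm_imset tpermV tpermL tpermD ?(negbTE hb) ?(negbTE hc) //.
  by apply: contraNneq hb => <-.
by rewrite sumr_const card_tops // natrM mulr_natl.
Qed.

End Polytabloids.

(** * Schur orthogonality for Specht modules *)

Section SpechtModules.
Variable n : nat.
Local Notation N := #|{set 'I_n}|.
Implicit Types (A B T : {set 'I_n}) (s : 'S_n) (p : seq ('I_n * 'I_n)).
Local Notation Tm := (@tabloid_perm_mx n).

Lemma rV_permE (v : 'rV[algC]_N) s j :
  (v *m Tm s) 0 j = v 0 (enum_rank ((s^-1)%g @: enum_val j)).
Proof.
have sK : s @: ((s^-1)%g @: enum_val j) = enum_val j :> {set 'I_n}.
  by apply/setP => i; rewrite !mem_perm_imset invgK permKV.
rewrite mxE (bigD1 (enum_rank ((s^-1)%g @: enum_val j))) //= big1 ?addr0.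
  by rewrite mxE enum_rankK sK eqxx mulr1.
move=> i ni; rewrite mxE; case: eqP => [e|]; last by rewrite mulr0.
case/eqP: ni; apply: enum_val_inj; rewrite enum_rankK e.
by apply/setP => k; rewrite !mem_perm_imset invgK permK.
Qed.

Lemma columns_mul x hx s t :
  supp (@columns n x hx (s * t)%g) = map t (supp (columns hx s)).
Proof.
rewrite !columns_supp map_cat; move: (enum _) => e.
by rewrite -!map_comp; congr (_ ++ _); apply: eq_map => j /=; rewrite permM.
Qed.

Lemma evec_perm x hx s t :
  evec (@columns n x hx s) *m Tm t = evec (columns hx (s * t)%g).
Proof.
have hm A i : (s i \in (t^-1)%g @: A) = ((s * t)%g i \in A).
  by rewrite mem_perm_imset invgK permM.
apply/rowP => j; rewrite rV_permE !mxE !enum_rankK; congr (_%:R * _).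
  congr nat_of_bool; apply/agree0P/agree0P => h i hi.
    have := h ((t^-1)%g i); rewrite mem_imset; last exact: perm_inj.
    by move=> /(_ hi) hs; rewrite columns_mul -(permKV t i) map_f.
  move: hi; rewrite mem_perm_imset invgK => /h.
  by rewrite columns_mul mem_map //; apply: perm_inj.
by rewrite /weight !big_map; apply: eq_bigr => k _ /=; rewrite !hm.
Qed.

Lemma specht_row x hx i :
  row i (specht_mx n x) = evec (@columns n x hx (enum_val i)).
Proof. by rewrite -row_specht enum_valK. Qed.

Lemma specht_stable x s : (x.*2 <= n)%N ->
  (specht_mx n x *m Tm s <= specht_mx n x)%MS.
Proof.
move=> hx; apply/row_subP => i; rewrite row_mul (specht_row hx) evec_perm.
by rewrite -row_specht row_sub.
Qed.

(* Abstracting the basis B of the Specht module and the matrices rho in that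
   basis prevents rewriting with mulmxA from unfolding row_base. *)
Section Specht.
Variables (x : nat) (hx : (x.*2 <= n)%N).
Local Notation Sx := (specht_mx n x).
Variables (d : nat) (B : 'M[algC]_(d, N)) (rho : 'S_n -> 'M[algC]_d).
Hypotheses (freeB : row_free B) (eqB : (B :=: Sx)%MS).
Hypothesis rhoE : forall s, rho s *m B = B *m Tm s.

Let injB m' : injective (fun M : 'M_(m', d) => M *m B).
Proof. exact: row_free_inj. Qed.

Lemma specht_repM s t : rho (s * t)%g = rho s *m rho t.
Proof. by apply: injB; rewrite -mulmxA !rhoE mulmxA rhoE -mulmxA -tabloid_permM. Qed.

Lemma specht_rep1 : rho 1%g = 1%:M.
Proof. by apply: injB; rewrite rhoE tabloid_perm1 mulmx1 mul1mx. Qed.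

Lemma specht_trV s : (\tr (rho s))^* = \tr (rho (s^-1)%g).
Proof.
have hr : mx_repr [set: 'S_n] rho.
  by split => [|s1 s2 _ _]; [exact: specht_rep1 | exact: specht_repM].
have := char_inv s (cfRepr_char (G := [set: 'S_n]%G) (MxRepresentation hr)).
by rewrite !cfunE !in_setT !mulr1n => <-.
Qed.

(** The antisymmetrizer comes from the group algebra, so in the basis [B] it is a matrix that
    commutes with every endomorphism. *)
Lemma specht_base_colmx (X : 'M[algC]_d) p : (forall s, X *m rho s = rho s *m X) ->
  exists2 Y, B *m colmx p = Y *m B & X *m Y = Y *m X.
Proof.
move=> hX; elim: p => [|ab p [Y hY cY]] /=.
  by exists 1%:M; rewrite ?mulmx1 ?mul1mx.
exists (Y - rho (tperm ab.1 ab.2) *m Y).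
  by rewrite !mulmxBl mul1mx mulmxBr hY mulmxA -rhoE -!mulmxA hY.
by rewrite mulmxBr mulmxBl !mulmxA hX -!mulmxA cY.
Qed.

(* James: the column antisymmetrizer sends the Specht module into the line of
   its polytabloid, so an endomorphism must scale every polytabloid. *)
Lemma specht_schur (X : 'M[algC]_d) : (forall s, X *m rho s = rho s *m X) ->
  exists c, X = c%:M.
Proof.
(* [U] expresses the polytabloids in the basis [B], and [Z] expresses [B] in the polytabloids. *)
move=> hX; have [U UB] : exists U, Sx = U *m B by apply/submxP; rewrite eqB.
have [Z ZS] : exists Z, B = Z *m Sx by apply/submxP; rewrite eqB.
have ZU : Z *m U = 1%:M by apply: injB; rewrite -mulmxA -UB -ZS mul1mx.
pose p := columns hx 1%g; have up : uniq (supp p) := columns_uniq hx 1%g.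
pose u s := row (enum_rank s) U.
have uB s : u s *m B = evec (columns hx s) by rewrite -row_mul -UB row_specht.
have [c1 hc1] : exists c1, u 1%g *m X = c1 *: u 1%g.
  have [Y hY cY] := specht_base_colmx p hX.
  have [c c0 hc] := evec_colmx up.
  have uY : u 1%g *m Y = c *: u 1%g.
    by apply: injB; rewrite -mulmxA -hY mulmxA uB hc -scalemxAl uB.
  set k := ((u 1%g *m X *m B) *m (evec p)^T) 0 0.
  have hk : (u 1%g *m X *m B) *m colmx p = k *: evec p.
    apply: mul_colmx => // i hi; rewrite ZS mulmxA mxE big1 // => j _.
    suff -> : Sx j i = 0 by rewrite mulr0.
    have := congr1 (fun v : 'rV_N => v 0 i) (specht_row hx j).
    rewrite mxE => ->; apply: evec_weight; first exact: columns_uniq.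
    by move: hi; rewrite !size_columns.
  (* Antisymmetrizing multiplies [u 1] by [c] and commutes with [X], while it sends [u 1 *m X] to
     [k] times the polytabloid. *)
  exists (c^-1 * k); apply: injB; apply: (scalerI c0).
  rewrite -scalemxAl uB scalerA mulrA divff // mul1r -hk -(mulmxA _ B) hY mulmxA.
  by rewrite -(mulmxA _ X Y) cY mulmxA uY -!scalemxAl.
exists c1; rewrite -[X]mul1mx -ZU -mulmxA.
(* All the polytabloids are translates of the first one, so [X] scales them by the same [c1]. *)
have -> : U *m X = c1 *: U.
  apply/row_matrixP => i; rewrite row_mul linearZ /= -(enum_valK i) -/(u _).
  have -> : u (enum_val i) = u 1%g *m rho (enum_val i).
    by apply: injB; rewrite uB -mulmxA rhoE mulmxA uB evec_perm mul1g.
  by rewrite -mulmxA -hX mulmxA hc1 -scalemxAl.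
by rewrite -scalemxAr ZU scalemx1.
Qed.

Lemma specht_schur_trace (X : 'M[algC]_d) : (forall s, X *m rho s = rho s *m X) ->
  d%:R *: X = (\tr X)%:M.
Proof.
by case/specht_schur => c ->; rewrite mxtrace_scalar scale_scalar_mx mulr_natl.
Qed.

(** Schur orthogonality: the group average [Y i j] of an elementary matrix is an endomorphism, hence
    a scalar fixed by its trace. The entries of the character sum are sums of entries of the
    [Y i j]. *)
Lemma specht_idempotent :
  (d%:R / (n`!)%:R) *: \sum_s (\tr (rho s))^* *: rho s = 1%:M.
Proof.
pose Y i j := \sum_s rho s *m delta_mx i j *m rho (s^-1)%g.
have cY i j t : Y i j *m rho t = rho t *m Y i j.
  rewrite mulmx_sumr mulmx_suml (reindex_inj (mulgI t)) /=; apply: eq_bigr => s _.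
  by rewrite -mulmxA -specht_repM invMg mulgKV specht_repM !mulmxA.
have YE i j a b : Y i j a b = \sum_s rho s a i * rho (s^-1)%g j b.
  rewrite summxE; apply: eq_bigr => s _.
  rewrite -(mul_delta_mx (0 : 'I_1)) mulmxA -colE -mulmxA -rowE.
  by rewrite mxE big_ord1 !mxE.
have trY i j : \tr (Y i j) = (i == j)%:R * (n`!)%:R.
  rewrite raddf_sum /= (eq_bigr (fun=> (i == j)%:R)).
    by rewrite sumr_const card_Sn mulr_natr.
  move=> s _; rewrite mxtrace_mulC mulmxA -specht_repM mulVg specht_rep1 mul1mx.
  rewrite /mxtrace (bigD1 j) //= mxE eqxx andbT big1 ?addr0 1?eq_sym //.
  by move=> k kj; rewrite mxE (negbTE kj) andbF.
apply/matrixP => a i; rewrite mxE summxE.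
rewrite (eq_bigr (fun s => \sum_j rho s a i * rho (s^-1)%g j j)); last first.
  by move=> s _; rewrite mxE specht_trV mulrC mulr_sumr.
rewrite exchange_big /= (eq_bigr (fun j => Y i j a j)); last by move=> j _; rewrite YE.
rewrite mulrAC mulr_sumr (eq_bigr (fun j => (i == j)%:R * (n`!)%:R * (a == j)%:R)).
  rewrite (bigD1 i) //= big1 => [|j ji]; last by rewrite eq_sym (negbTE ji) !mul0r.
  rewrite eqxx addr0 mul1r mulrAC divff ?mul1r ?mxE //.
  by rewrite pnatr_eq0 -lt0n fact_gt0.
move=> j _; have := congr1 (fun M : 'M_d => M a j) (specht_schur_trace (cY i j)).
rewrite mxE => ->; rewrite mxE trY.
by case: (a == j); rewrite ?mulr1 ?mulr0.
Qed.
End Specht.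

End SpechtModules.

(** * Completeness of the isotypic projections *)

Section Isotypic.
Variable n : nat.
Local Notation N := #|{set 'I_n}|.
Implicit Types (A B T : {set 'I_n}) (s : 'S_n) (p : seq ('I_n * 'I_n)).
Local Notation Tm := (@tabloid_perm_mx n).

(** Supplies the abstract basis and matrices that the results on Specht modules take as
    hypotheses. *)
Lemma specht_basis x : (x.*2 <= n)%N ->
  exists (B : 'M[algC]_(specht_dim n x, N)) (rho : 'S_n -> 'M[algC]_(specht_dim n x)),
  [/\ row_free B, (B :=: specht_mx n x)%MS, forall s, rho s *m B = B *m Tm s
    & forall s, specht_char n x s = \tr (rho s)].
Proof.
move=> hx; exists (row_base (specht_mx n x)).
exists (fun s => row_base (specht_mx n x) *m Tm s *m pinvmx (row_base (specht_mx n x))).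
split=> // [||s]; [exact: row_base_free | exact: eq_row_base |].
rewrite mulmxKpV // eq_row_base.
by apply: submx_trans (specht_stable s hx); rewrite submxMr // eq_row_base.
Qed.

Definition isotypic_mx x : 'M[algC]_N :=
  (specht_dim n x)%:R / (n`!)%:R *: \sum_s (specht_char n x s)^* *: Tm s.

Lemma comm_isotypic_mx x (M : 'M[algC]_N) : (forall s, Tm s *m M = M *m Tm s) ->
  isotypic_mx x *m M = M *m isotypic_mx x.
Proof.
move=> h; rewrite -scalemxAl -scalemxAr mulmx_suml mulmx_sumr; congr (_ *: _).
by apply: eq_bigr => s _; rewrite -scalemxAl -scalemxAr h.
Qed.

Lemma isotypic_mx_perm x t : (x.*2 <= n)%N ->
  Tm t *m isotypic_mx x = isotypic_mx x *m Tm t.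
Proof.
move=> /specht_basis [B [rho [freeB eqB rhoE chiE]]].
rewrite -scalemxAl -scalemxAr mulmx_suml mulmx_sumr; congr (_ *: _).
rewrite (reindex_inj (conjg_inj t)); apply: eq_bigr => s _ /=.
rewrite -scalemxAl -scalemxAr -!tabloid_permM -conjgC; congr (_^* *: _).
rewrite conjgE !chiE !(specht_repM freeB rhoE) mxtrace_mulC -mulmxA.
by rewrite -(specht_repM freeB rhoE) mulgV (specht_rep1 freeB rhoE) mulmx1.
Qed.

Lemma specht_isotypic x : (x.*2 <= n)%N ->
  specht_mx n x *m isotypic_mx x = specht_mx n x.
Proof.
move=> hx; have [B [rho [freeB eqB rhoE chiE]]] := specht_basis hx.
have [U ->] : exists U, specht_mx n x = U *m B by apply/submxP; rewrite eqB.
have := specht_idempotent hx freeB eqB rhoE => id1.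
rewrite -mulmxA; congr (_ *m _); rewrite -[RHS]mul1mx -id1 -scalemxAl -scalemxAr.
congr (_ *: _); rewrite mulmx_sumr mulmx_suml; apply: eq_bigr => s _.
by rewrite -scalemxAl -scalemxAr rhoE chiE.
Qed.

Definition casimir_eig x : algC := (x * (n.+1 - x)).*2%:R.

Lemma specht_casimir x : (x.*2 <= n)%N ->
  specht_mx n x *m casimir n = casimir_eig x *: specht_mx n x.
Proof.
move=> hx; apply/row_matrixP => i; rewrite row_mul linearZ /= (specht_row hx).
by rewrite evec_casimir ?columns_uniq // size_columns.
Qed.

(** Valid on all of tensor space: reindexing the sum over the group moves [casimir] from the
    operators [Tm s] into the traces of [rho], where it is a scalar. *)
Lemma isotypic_casimir x : (x.*2 <= n)%N ->
  isotypic_mx x *m casimir n = casimir_eig x *: isotypic_mx x.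
Proof.
move=> hx; have [B [rho [freeB eqB rhoE chiE]]] := specht_basis hx.
have BE : B *m casimir n = casimir_eig x *: B.
  have [Z ->] : exists Z, B = Z *m specht_mx n x by apply/submxP; rewrite eqB.
  by rewrite -mulmxA specht_casimir // scalemxAr.
have rE : \sum_a \sum_b (1%:M - rho (tperm a b)) = (casimir_eig x)%:M.
  apply: (row_free_inj freeB); rewrite mul_scalar_mx -BE /casimir.
  rewrite mulmx_suml mulmx_sumr; apply: eq_bigr => a _.
  rewrite mulmx_suml mulmx_sumr; apply: eq_bigr => b _.
  by rewrite mulmxBl mulmxBr rhoE mul1mx mulmx1.
have cE s : (specht_char n x s)^* = \tr (rho (s^-1)%g).
  by rewrite chiE (specht_trV freeB rhoE).
rewrite /isotypic_mx -scalemxAl [RHS]scalerA [casimir_eig x * _]mulrC -[RHS]scalerA.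
congr (_ *: _).
rewrite /casimir mulmx_sumr.
transitivity (\sum_a \sum_b \sum_s
    (\tr ((1%:M - rho (tperm a b)) *m rho (s^-1)%g)) *: Tm s).
  apply: eq_bigr => a _; rewrite mulmx_sumr; apply: eq_bigr => b _.
  rewrite mulmxBr mulmx1 mulmx_suml [X in _ - X](reindex_inj (mulIg (tperm a b))) /=.
  rewrite -sumrB; apply: eq_bigr => s _.
  rewrite -scalemxAl -tabloid_permM -mulgA tperm2 mulg1 -scalerBl !cE.
  by rewrite mulmxBl mul1mx -(specht_repM freeB rhoE) raddfB /= invMg tpermV.
rewrite scaler_sumr (eq_bigr (fun a => \sum_s (\sum_b
    \tr ((1%:M - rho (tperm a b)) *m rho (s^-1)%g)) *: Tm s)); last first.
  by move=> a _; rewrite exchange_big; apply: eq_bigr => s _; rewrite scaler_suml.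
rewrite exchange_big; apply: eq_bigr => s _ /=; rewrite -scaler_suml scalerA.
congr (_ *: _); rewrite cE -mxtraceZ -mul_scalar_mx -rE mulmx_suml raddf_sum /=.
by apply: eq_bigr => a _; rewrite mulmx_suml raddf_sum.
Qed.

(** Applying [casimir] on either side of the projection gives both eigenvalues, and x (n + 1 - x) is
    injective for 2 x <= n. *)
Lemma specht_isotypic0 x y : (x.*2 <= n)%N -> (y.*2 <= n)%N -> x != y ->
  specht_mx n y *m isotypic_mx x = 0.
Proof.
move=> hx hy nxy.
have : (casimir_eig x - casimir_eig y) *: (specht_mx n y *m isotypic_mx x) = 0.
  rewrite scalerBl scalemxAr -isotypic_casimir // scalemxAl -specht_casimir //.
  by rewrite -mulmxA comm_isotypic_mx ?subrr //; apply: casimir_perm.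
move/eqP; rewrite scaler_eq0 subr_eq0 eqr_nat => /orP [|/eqP //].
by move=> /eqP h; case/eqP: nxy; nia.
Qed.

(** The divided power E^c / c! of the sl_2 raising operator E that adds one point to a subset in all
    possible ways. *)
Definition raise c : 'M[algC]_N := \matrix_(i, j)
  let A := enum_val i : {set 'I_n} in let T := enum_val j : {set 'I_n} in
  ((A \subset T) && (#|T| == #|A| + c)%N)%:R.

Lemma raise_perm c s : Tm s *m raise c = raise c *m Tm s.
Proof.
apply/matrixP => i j; rewrite perm_mulmxE.
have -> : (raise c *m Tm s) i j = (row i (raise c) *m Tm s) 0 j.
  by rewrite -row_mul [RHS]mxE.
rewrite rV_permE !mxE /= !enum_rankK !card_imset; try exact: perm_inj.
congr (nat_of_bool (_ && _))%:R; apply/subsetP/subsetP => h k hk.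
  rewrite mem_perm_imset invgK; apply: h.
  by rewrite mem_imset //; apply: perm_inj.
have := h ((s^-1)%g k); rewrite mem_perm_imset invgK permKV; apply.
by rewrite -mem_perm_imset.
Qed.

Lemma delta_raise c A q (M : 'M[algC]_(N, q)) : delta A *m raise c *m M =
  \sum_(T : {set 'I_n} | (A \subset T) && (#|T| == #|A| + c)%N) delta T *m M.
Proof.
have -> : delta A *m raise c =
    \sum_(T : {set 'I_n} | (A \subset T) && (#|T| == #|A| + c)%N) delta T.
  rewrite delta_mul; apply/rowP => j; rewrite !mxE enum_rankK summxE.
  rewrite big_mkcond (bigD1 (enum_val j)) //= big1 ?addr0.
    by case: ifP => // _; rewrite mxE enum_valK !eqxx.
  move=> T nT; case: ifP => // _; rewrite mxE eqxx /=; case: eqP => // e.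
  by case/eqP: nT; rewrite e enum_rankK.
by rewrite mulmx_suml.
Qed.

Lemma size_supp p : uniq (supp p) -> ((size p).*2 <= n)%N.
Proof.
move=> u; have := max_card (mem (supp p)).
by rewrite (card_uniqP u) card_ord size_cat !size_map addnn.
Qed.

Lemma evec_specht p : uniq (supp p) ->
  exists i, evec p = row i (specht_mx n (size p)).
Proof.
move=> u; have [hx [s es]] := columns_surj u.
by exists (enum_rank s); rewrite (row_specht hx) es.
Qed.

(** Exchanging a point of [A] outside [T] with a point of [T] outside [A] preserves [g] and shrinks
    the difference. *)
Lemma swap_invariant (g : {set 'I_n} -> 'rV[algC]_N) p :
  (forall A a b, a != b -> a \notin supp p -> b \notin supp p ->
    g (tperm a b @: A) = g A) ->
  forall A T, {in supp p, A =i T} -> #|A| = #|T| -> g A = g T.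
Proof.
move=> gs A T; have [k] := ubnP #|A :\: T|.
elim: k A => // k IH A hk hAT hc.
have [AT|nAT] := boolP (A \subset T).
  by congr g; apply/eqP; rewrite eqEcard AT hc /=.
have [a aA aT] := subsetPn nAT.
have [b bT bA] : exists2 b, b \in T & b \notin A.
  apply/subsetPn; apply: contra nAT => TA.
  by have /eqP -> : T == A by rewrite eqEcard TA hc /=.
have as' : a \notin supp p by apply: contraNN aT => /hAT <-.
have bs' : b \notin supp p by apply: contraNN bA => /hAT ->.
have nab : a != b by apply: contraNneq aT => ->.
rewrite -(gs A a b nab as' bs'); apply: IH.
- rewrite -ltnS; apply: leq_trans hk; rewrite ltnS.
  apply/proper_card/properP; split; last first.
    exists a; first by rewrite inE aA aT.
    by rewrite inE mem_perm_imset tpermV tpermL (negbTE bA) andbF.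
  apply/subsetP => i; rewrite !inE mem_perm_imset tpermV => /andP [iT].
  by rewrite iT; case: tpermP iT => [->|->|//]; rewrite ?(negbTE bA) ?bT.
- move=> i hi; rewrite mem_perm_imset tpermV tpermD ?hAT //.
    by apply: contraNneq as' => ->.
  by apply: contraNneq bs' => ->.
- by rewrite card_imset //; apply: perm_inj.
Qed.

(* Antisymmetrizing in a further pair of free positions gives 0 by induction, so
   delta A *m colmx p *m Q only depends on the size of A outside supp p; and the
   sum of these vectors over all such A comes from a polytabloid via raise. *)
Lemma colmx_kill (Q : 'M[algC]_N) :
  (forall s, Tm s *m Q = Q *m Tm s) -> (forall c, raise c *m Q = Q *m raise c) ->
  (forall x, (x.*2 <= n)%N -> specht_mx n x *m Q = 0) -> Q = 0.
Proof.
move=> Qs Qr Qx.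
(* Induction on the number of positions outside the pairs; the empty list of pairs gives [Q]
   itself. *)
suff K r p : uniq (supp p) -> (n - (size p).*2 < r)%N -> colmx p *m Q = 0.
  by rewrite -[Q]mul1mx; apply: (K n.+1 [::]) => //=; rewrite subn0.
elim: r p => // r IH p u hr.
pose g A := delta A *m (colmx p *m Q).
have gs A a b : a != b -> a \notin supp p -> b \notin supp p ->
    g (tperm a b @: A) = g A.
  move=> nab ha hb.
  have u' : uniq (supp ((a, b) :: p)).
    by rewrite (perm_uniq (supp_cons a b p)) /= inE negb_or nab ha hb.
  have h0 : colmx ((a, b) :: p) *m Q = 0.
    by apply: IH => //; have := size_supp u'; rewrite /=; lia.
  have := congr1 (mulmx (delta A)) h0; rewrite mulmx0 /= -(mulmxA _ (colmx p)).
  rewrite (mulmxA (delta A) (_ - _)) mulmxBr mulmx1 delta_perm mulmxBl.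
  by move=> /subr0_eq/esym.
have g0 A : weight p A = 0 -> g A = 0.
  move=> w0; rewrite /g mulmxA delta_mul.
  suff -> : row (enum_rank A) (colmx p) = 0 by rewrite mul0mx.
  by apply/rowP => j; rewrite !mxE colmxE // enum_rankK w0 mul0r mulr0.
suff gA A : g A = 0 by apply/row_matrixP => i; rewrite row0 row_delta -/(g _) gA.
have [/g0 //|w] := eqVneq (weight p A) 0.
pose A0 := [set i in A | i \in supp p]; pose c := (#|A| - #|A0|)%N.
have sA0 : A0 \subset A by apply/subsetP => i; rewrite inE => /andP [].
have cA0 : #|A0| = size p := card_supp u w.
have cA : #|A| = (#|A0| + c)%N by rewrite subnKC ?subset_leq_card.
(* [raise c] can be moved to the end, past the antisymmetrizer and [Q]; what precedes it is a
   polytabloid times [Q], which vanishes. *)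
have : delta A0 *m raise c *m (colmx p *m Q) = 0.
  rewrite -mulmxA (mulmxA (raise c)) -(comm_colmx p (raise_perm c)).
  rewrite -mulmxA Qr !mulmxA delta_colmx //; have [i ->] := evec_specht u.
  by rewrite -scalemxAl -row_mul Qx ?size_supp // row0 scaler0 mul0mx.
rewrite delta_raise (bigID (fun T => weight p T == 0)) /= big1 => [|T]; last first.
  by move=> /andP [_ /eqP /g0].
(* A set of nonzero weight that contains [A0] coincides with [A0] on the pairs, so every remaining
   term is [g A]. Their number is positive because [A] is among these sets. *)
rewrite add0r (eq_bigr (fun=> g A)) => [|T /andP [/andP [sT /eqP cT] wT]]; last first.
  apply: (swap_invariant gs); last by rewrite cT cA.
  have /eqP e : A0 == [set i in T | i \in supp p].
    rewrite eqEcard (card_supp u wT) cA0 leqnn andbT.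
    by apply/subsetP => i hi; rewrite inE (subsetP sT) //; move: hi;
      rewrite inE => /andP [].
  by move=> i hi; move/setP/(_ i): e; rewrite !inE hi !andbT => ->.
rewrite sumr_const => /eqP; rewrite -scaler_nat scaler_eq0 pnatr_eq0 => /orP [|/eqP //].
move=> /eqP /card0_eq /(_ A).
by rewrite unfold_in /= sA0 cA eqxx w.
Qed.

Lemma isotypic_sum : \sum_(0 <= x < n./2.+1) isotypic_mx x = 1%:M.
Proof.
have hx x : (x < n./2.+1)%N -> (x.*2 <= n)%N by lia.
apply/eqP; rewrite eq_sym -subr_eq0; apply/eqP; apply: colmx_kill.
- move=> s; rewrite mulmxBl mulmxBr mulmx1 mul1mx mulmx_sumr mulmx_suml.
  rewrite !big_mkord; congr (_ - _); apply: eq_bigr => x _.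
  by rewrite isotypic_mx_perm ?hx.
- move=> c; rewrite mulmxBl mulmxBr mulmx1 mul1mx mulmx_sumr mulmx_suml.
  congr (_ - _); apply: eq_bigr => x _.
  by rewrite comm_isotypic_mx //; apply: raise_perm.
- move=> y hy; rewrite mulmxBr mulmx1 mulmx_sumr big_mkord.
  have hy' : (y < n./2.+1)%N by lia.
  rewrite (bigD1 (Ordinal hy')) //= specht_isotypic // big1 ?addr0 ?subrr //.
  move=> x nxy; apply: specht_isotypic0 => //; first exact: hx.
Qed.

End Isotypic.

(** * The overlap of Xi with the isotypic components *)

Section Overlaps.
Variable n : nat.
Local Notation N := #|{set 'I_n}|.
Implicit Types (A B T : {set 'I_n}) (s : 'S_n) (p : seq ('I_n * 'I_n)).
Local Notation Tm := (@tabloid_perm_mx n).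

Definition ket A : basis_idx n := [ffun i => i \in A].
Definition ones (b : basis_idx n) : {set 'I_n} := [set i | b i].

Lemma ketK : cancel ket ones.
Proof. by move=> A; apply/setP => i; rewrite inE ffunE. Qed.

Lemma onesK : cancel ones ket.
Proof. by move=> b; apply/ffunP => i; rewrite ffunE inE. Qed.

Definition coords (v : tvec n) : 'rV[algC]_N := \row_j v (ket (enum_val j)).

Lemma coordsE v b : v b = coords v 0 (enum_rank (ones b)).
Proof. by rewrite mxE enum_rankK onesK. Qed.

Lemma perm_actE s v b : perm_act n s v b = (coords v *m Tm s) 0 (enum_rank (ones b)).
Proof.
rewrite rV_permE !mxE !enum_rankK; congr v; apply/ffunP => i.
by rewrite !ffunE mem_perm_imset invgK inE.
Qed.

Lemma isotypic_projE x v b :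
  isotypic_proj n x v b = (coords v *m isotypic_mx n x) 0 (enum_rank (ones b)).
Proof.
rewrite /isotypic_proj -scalemxAr mxE mulmx_sumr summxE; congr (_ * _).
by apply: eq_bigr => s _; rewrite perm_actE -scalemxAr [RHS]mxE.
Qed.

Definition dual (v : 'rV[algC]_N) : 'cV[algC]_N := \col_j (v 0 j)^*.

Lemma innerE (u v : tvec n) (w : 'rV[algC]_N) :
  (forall b, v b = w 0 (enum_rank (ones b))) ->
  inner n u v = (w *m dual (coords u)) 0 0.
Proof.
move=> hv; rewrite mxE (reindex enum_rank) /=; last first.
  by apply: onW_bij; apply: enum_rank_bij.
rewrite (reindex ones) /=; last first.
  by apply: onW_bij; exists ket; [apply: onesK|apply: ketK].
by apply: eq_bigr => b _; rewrite hv [in RHS]mxE -coordsE mulrC.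
Qed.

Lemma card_ord_lt l : (l <= n)%N -> #|[set i : 'I_n | (i < l)%N]| = l.
Proof.
move=> hl; have inj : injective (widen_ord hl).
  by move=> i j /(congr1 val) /= e; apply: val_inj.
rewrite -[RHS]card_ord -[RHS](card_imset _ inj); congr #|pred_of_set _|.
apply/setP => i; rewrite inE; apply/idP/imsetP => [il|[j _ ->] //=].
by exists (Ordinal il) => //; apply: val_inj.
Qed.

(** * Transposition counts on the support of [Xi] *)

Section Overlap.
Variables m k l : nat.
Hypotheses (hm : (m <= n)%N) (hk : (k <= n)%N) (hmk : (m + k <= n + l)%N).
Hypotheses (hlm : (l <= m)%N) (hlk : (l <= k)%N).

Definition xi_support : {set {set 'I_n}} := [set A : {set 'I_n} |
  [&& [forall i : 'I_n, (i < l)%N ==> (i \in A)],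
      [forall i : 'I_n, (l <= i < k)%N ==> (i \notin A)] &
      #|[set i : 'I_n | (k <= i)%N && (i \in A)]| == Mpar m l]].

Definition xi_norm : algC := (sqrtC ('C(Mpar m l + Npar n m k l, Mpar m l))%:R)^-1.

Definition indicator (F : {set {set 'I_n}}) : 'rV[algC]_N :=
  \row_j (enum_val j \in F)%:R.

Lemma coords_Xi : coords (Xi n m k l) = xi_norm *: indicator xi_support.
Proof.
apply/rowP => j; rewrite !mxE /Xi inE.
have -> : [forall i : 'I_n, (i < l)%N ==> ket (enum_val j) i] =
    [forall i : 'I_n, (i < l)%N ==> (i \in enum_val j)].
  by apply: eq_forallb => i; rewrite ffunE.
have -> : [forall i : 'I_n, (l <= i < k)%N ==> ~~ ket (enum_val j) i] =
    [forall i : 'I_n, (l <= i < k)%N ==> (i \notin enum_val j)].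
  by apply: eq_forallb => i; rewrite ffunE.
have -> : [set i : 'I_n | (k <= i)%N && ket (enum_val j) i] =
    [set i : 'I_n | (k <= i)%N && (i \in enum_val j)].
  by apply/setP => i; rewrite !inE ffunE.
by case: ifP => _; rewrite ?mulr1 ?mulr0.
Qed.

Lemma indicator_sum F q (M : 'M[algC]_(N, q)) :
  indicator F *m M = \sum_(A in F) delta A *m M.
Proof.
have -> : indicator F = \sum_(A in F) delta A; last by rewrite mulmx_suml.
apply/rowP => j; rewrite mxE summxE.
rewrite big_mkcond (bigD1 (enum_val j)) //= big1 ?addr0.
  by case: ifP => // _; rewrite mxE enum_valK !eqxx.
move=> T nT; case: ifP => // _; rewrite mxE eqxx /=; case: eqP => // e.
by case/eqP: nT; rewrite e enum_rankK.
Qed.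

Lemma delta_indicator A F : (delta A *m (indicator F)^T) 0 0 = (A \in F)%:R.
Proof. by rewrite delta_mul !mxE enum_rankK. Qed.

Definition overlap (M : 'M[algC]_N) : algC :=
  (coords (Xi n m k l) *m M *m dual (coords (Xi n m k l))) 0 0.

Lemma pdistE x : pdist n m k l x = overlap (isotypic_mx n x).
Proof. by apply: innerE => b; apply: isotypic_projE. Qed.

Lemma overlap_sum (c : nat -> algC) :
  \sum_(0 <= x < n./2.+1) c x * pdist n m k l x =
  overlap (\sum_(0 <= x < n./2.+1) c x *: isotypic_mx n x).
Proof.
rewrite /overlap mulmx_sumr mulmx_suml summxE; apply: eq_bigr => x _.
by rewrite pdistE -scalemxAr -scalemxAl [RHS]mxE.
Qed.

Lemma overlapE (M : 'M[algC]_N) : overlap M =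
  ('C(Mpar m l + Npar n m k l, Mpar m l))%:R^-1 *
  \sum_(A in xi_support) (delta A *m M *m (indicator xi_support)^T) 0 0.
Proof.
have hc : xi_norm^* = xi_norm.
  by apply/CrealP; rewrite rpredV ger0_real // sqrtC_ge0 ler0n.
rewrite /overlap.
have -> : dual (coords (Xi n m k l)) =
    xi_norm *: (indicator xi_support)^T.
  by apply/colP => j; rewrite coords_Xi !mxE rmorphM /= hc conjC_nat.
rewrite coords_Xi -!scalemxAl -scalemxAr scalerA mxE.
rewrite -expr2 exprVn sqrtCK; congr (_ * _).
by rewrite indicator_sum mulmx_suml summxE.
Qed.

Let low : {set 'I_n} := [set i : 'I_n | (i < l)%N].
Let top : {set 'I_n} := [set i : 'I_n | (k <= i)%N].

Let card_low : #|low| = l. Proof. by rewrite card_ord_lt //; lia. Qed.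

Let card_top : #|top| = (n - k)%N.
Proof.
have -> : top = ~: [set i : 'I_n | (i < k)%N].
  by apply/setP => i; rewrite !inE -leqNgt.
by rewrite cardsCs setCK card_ord card_ord_lt.
Qed.

Lemma xi_supportP A : reflect
  ((forall i : 'I_n, (i < k)%N -> (i \in A) = (i < l)%N) /\ #|A :&: top| = Mpar m l)
  (A \in xi_support).
Proof.
have -> : A :&: top = [set i : 'I_n | (k <= i)%N && (i \in A)].
  by apply/setP => i; rewrite !inE andbC.
rewrite inE; apply: (iffP and3P) => [[/forallP h1 /forallP h2 /eqP h3]|[h h3]]; split.
- move=> i ik; case: ltnP => il; first by have := h1 i; rewrite il.
  by have := h2 i; rewrite il ik /= => /negbTE.
- exact: h3.
- by apply/forallP => i; apply/implyP => il; rewrite h //; lia.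
- by apply/forallP => i; apply/implyP => /andP [il ik]; rewrite h // -leqNgt.
- exact/eqP.
Qed.

Lemma xi_support_split A : A \in xi_support -> A = low :|: (A :&: top).
Proof.
case/xi_supportP => h _; apply/setP => i; rewrite !inE.
case: (ltnP i k) => ik; first by rewrite h // andbF orbF.
by rewrite ltnNge (leq_trans hlk ik) andbT.
Qed.

(** A member of the support is determined by its trace on the n - k free positions, an arbitrary
    subset of size [Mpar m l]. *)
Lemma card_xi_support :
  #|xi_support| = 'C(Mpar m l + Npar n m k l, Mpar m l).
Proof.
have -> : (Mpar m l + Npar n m k l = n - k)%N by rewrite /Mpar /Npar; lia.
rewrite -card_top -cards_draws.
have low_top i : i \in low -> i \notin top by rewrite !inE -ltnNge; lia.
rewrite -(card_in_imset (f := fun A => A :&: top) (D := mem xi_support)); last first.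
  move=> A T /xi_support_split hA /xi_support_split hT e.
  by rewrite hA hT e.
congr #|pred_of_set _|; apply/setP => C; rewrite inE; apply/imsetP/andP.
  by case=> A /xi_supportP [_ h] ->; rewrite h subsetIr eqxx.
case=> sC /eqP cC; have e : C = (low :|: C) :&: top.
  apply/setP => i; rewrite in_setI in_setU.
  case: (boolP (i \in low)) => [/low_top hi|_] /=.
    by rewrite (negbTE hi); apply: contraNF hi; apply: subsetP sC i.
  by case: (boolP (i \in C)) => // /(subsetP sC) ->.
exists (low :|: C) => //; apply/xi_supportP; split; last by rewrite -e.
move=> i ik; rewrite in_setU inE; case: ltnP => //= _.
by apply: contraTF ik => /(subsetP sC); rewrite inE -leqNgt.
Qed.

(** Membership is prescribed at the positions below [k], so only an exchange between two free
    positions stays in the support. *)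
Lemma xi_support_swap A a b : A \in xi_support -> a \in A -> b \notin A ->
  (tperm a b @: A \in xi_support) = (k <= a)%N && (k <= b)%N.
Proof.
move=> /xi_supportP [h hM] aA bA.
have mA i : (i \in tperm a b @: A) = (tperm a b i \in A).
  by rewrite mem_perm_imset tpermV.
apply/xi_supportP/andP => [[h' _]|[ka kb]].
  split; rewrite leqNgt; apply/negP => ik.
    by have := h' a ik; rewrite mA tpermL (negbTE bA) -(h a ik) aA.
  by have := h' b ik; rewrite mA tpermR aA -(h b ik) (negbTE bA).
split=> [i ik|].
  by rewrite mA tpermD ?h //; apply: contraTneq ik => <-; rewrite -leqNgt.
rewrite -hM -[RHS](card_imset _ (@perm_inj _ (tperm a b))); congr #|pred_of_set _|.
apply/setP => i; rewrite in_setI [in RHS]mem_perm_imset tpermV in_setI mA.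
congr (_ && _).
by rewrite !inE; case: tpermP => [->|->|]; rewrite ?ka ?kb.
Qed.

Lemma overlap1 : overlap 1%:M = 1.
Proof.
rewrite overlapE (eq_bigr (fun=> 1)) => [|A hA]; last first.
  by rewrite mulmx1 delta_indicator hA.
rewrite sumr_const card_xi_support mulVf // pnatr_eq0 -lt0n bin_gt0.
exact: leq_addr.
Qed.

(** This is the eta of the theorem times n^2. *)
Let K : algC := (m * (n - m))%:R - ((m - l) * (n + l - (m + k)))%:R.

(** Of the m (n - m) exchanges between [A] and its complement, those between a free one and a free
    zero stay in the support and are subtracted. *)
Lemma swap_count A : A \in xi_support ->
  \sum_(a in A) \sum_(b in ~: A)
    (1 - (tperm a b @: A \in xi_support)%:R : algC) = K.
Proof.
move=> hA; have [h hM] := xi_supportP _ hA.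
have cA : #|A| = m.
  rewrite (xi_support_split hA) cardsU card_low hM.
  have -> : low :&: (A :&: top) = set0.
    by apply/setP => i; rewrite !inE; apply/negP; lia.
  by rewrite cards0 /Mpar; lia.
have cTA : #|~: A :&: top| = (n + l - (m + k))%N.
  have := cardsID A top; rewrite card_top setIC hM setDE setIC /Mpar; lia.
rewrite (eq_bigr (fun a : 'I_n => \sum_(b in ~: A)
    (1 - (k <= a)%:R * (k <= b)%:R : algC))); last first.
  move=> a aA; apply: eq_bigr => b; rewrite inE => bA.
  by rewrite xi_support_swap // -natrM mulnb.
rewrite (eq_bigr (fun a : 'I_n => (n - m)%:R - (k <= a)%:R * (n + l - (m + k))%:R)).
  rewrite sumrB sumr_const cA -mulr_suml /K natrM mulr_natl; congr (_ - _).
  rewrite natrM; congr (_ * _).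
  rewrite -[(m - l)%N]/(Mpar m l) -hM -sum1_card natr_sum big_mkcond [RHS]big_mkcond.
  by apply: eq_bigr => i _; rewrite !inE; case: (i \in A); case: (k <= i)%N.
move=> a _; rewrite sumrB sumr_const cardsCs setCK card_ord cA -mulr_sumr.
congr (_ - _ * _); rewrite -cTA -sum1_card natr_sum big_mkcond [RHS]big_mkcond.
by apply: eq_bigr => i _; rewrite !inE; case: (i \in A); case: (k <= i)%N.
Qed.

(** Every member of the support contributes the same count, so the normalization cancels the size of
    the support. *)
Lemma overlap_casimir : overlap (casimir n) = K *+ 2.
Proof.
rewrite overlapE (eq_bigr (fun=> K *+ 2)) => [|A hA].
  rewrite sumr_const card_xi_support -[X in _ * X]mulr_natl mulKf //.
  by rewrite pnatr_eq0 -lt0n bin_gt0 leq_addr.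
rewrite -(swap_count hA); have := sum_tperm A (fun T => (T \in xi_support)%:R).
rewrite hA => <-; rewrite mulmx_sumr mulmx_suml summxE; apply: eq_bigr => a _.
rewrite mulmx_sumr mulmx_suml summxE; apply: eq_bigr => b _.
rewrite mulmxBr mulmx1 delta_perm mulmxBl mxE delta_indicator hA.
by rewrite [X in _ + X]mxE delta_indicator.
Qed.

(** * Moments of the distribution *)

Lemma sum_pdist : \sum_(0 <= x < n./2.+1) pdist n m k l x = 1.
Proof.
rewrite -overlap1 -isotypic_sum.
under eq_bigr => x _ do rewrite -[pdist _ _ _ _ _]mul1r.
by rewrite overlap_sum; congr overlap; apply: eq_bigr => x _; rewrite scale1r.
Qed.

Lemma sum_casimir_pdist :
  \sum_(0 <= x < n./2.+1) casimir_eig n x * pdist n m k l x = K *+ 2.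
Proof.
rewrite overlap_sum -overlap_casimir; congr overlap.
rewrite -[RHS]mul1mx -isotypic_sum mulmx_suml; apply: eq_big_nat => x hx.
by rewrite isotypic_casimir //; lia.
Qed.

(** The expectation of 2 X (n + 1 - X) equals 2 [K]; it is solved for the expectation of X^2. *)
Lemma second_moment :
  \sum_(0 <= x < n./2.+1) x%:R ^+ 2 * pdist n m k l x = n.+1%:R * EX n m k l - K.
Proof.
have h2 : (2%:R : algC) != 0 by rewrite pnatr_eq0.
apply: (mulfI h2); rewrite mulrBr [2%:R * K]mulr_natl -sum_casimir_pdist /EX.
rewrite !mulr_sumr -sumrB; apply: eq_big_nat => x hx.
rewrite /casimir_eig -mul2n !natrM natrB; last by lia.
by ring.
Qed.
End Overlap.

End Overlaps.

Theorem theorem4p12 (n m k l : nat) :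
  (1 <= n)%N -> (m <= n)%N -> (k <= n)%N ->
  (m + k <= n + l)%N -> (l <= m)%N -> (l <= k)%N ->
  VX n m k l / (n ^ 2)%:R =
    EX n m k l / n%:R * (1 - EX n m k l / n%:R)
    + EX n m k l / (n ^ 2)%:R - eta_param n m k l.
Proof.
move=> n1 hm hk hmk hlm hlk.
have n0 : n%:R != 0 :> algC by rewrite pnatr_eq0 -lt0n.
have p1 := sum_pdist hm hk hmk hlm hlk.
have p2 := second_moment hm hk hmk hlm hlk.
rewrite /VX /eta_param natrX; set E := EX n m k l in p2 *.
(* The usual variance formula, which relies on the total mass [p1]. *)
have -> : \sum_(0 <= x < n./2.+1) (x%:R - E) ^+ 2 * pdist n m k l x =
    \sum_(0 <= x < n./2.+1) x%:R ^+ 2 * pdist n m k l x - E ^+ 2.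
  transitivity (\sum_(0 <= x < n./2.+1) x%:R ^+ 2 * pdist n m k l x
      - E *+ 2 * E + E ^+ 2 * \sum_(0 <= x < n./2.+1) pdist n m k l x).
    rewrite {3}/E /EX !mulr_sumr -sumrB -big_split /=.
    by apply: eq_bigr => x _; ring.
  by rewrite p1; ring.
by rewrite p2 -natr1; field.
Qed.
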